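(* Let $n\ge 2$ and let $(X_i)_{i\ge1}$ be a Markov chain on a discrete (finite) state space, with $X_1\sim P_1$ and transition matrices $K_1,K_2,\ldots$, so that $X_i$ has pmf $P_i=P_1K_1\cdots K_{i-1}$. For each $i$, let $K_i^{\leftarrow}$ be the backward channel of $K_i$ with respect to $P_i$, $K_i^{\leftarrow}(x|y)=K_i(y|x)P_i(x)/P_{i+1}(y)$, acting on functions $g$ by $(K_i^\leftarrow g)(y)=\sum_x K_i^\leftarrow(x|y)g(x)$, and for $1\le\gamma\le\alpha$ let $\|K_i^\leftarrow\|_{\alpha\to\gamma}=\sup_{g\neq0}\|K_i^\leftarrow g\|_{L^\alpha(P_{i+1})}/\|g\|_{L^\gamma(P_i)}$. For $\alpha>1$ let $\gamma_i^\star(\alpha)$ be the smallest $\gamma$ such that $K_i$ is hypercontractive, i.e. $\|K_i\|_{\alpha\to\gamma}\le 1$, and let $\bar\gamma_i^\star(\alpha)$ be its Hölder conjugate. Let $f$ satisfy the bounded-differences condition $|f(x_1,\ldots,x_i,\ldots,x_n)-f(x_1,\ldots,\hat x,\ldots,x_n)|\le 1/n$ for all $x^n,\hat x$ and $1\le i\le n$. Then for every $\alpha>1$ (with $\beta=\alpha/(\alpha-1)$) and every $t>0$, $$\mathcal{P}_{X^n}\left(\left|f-\mathcal{P}_{\bigotimes_{i=1}^n X_i}(f)\right|\ge t\right)\le 2^{1/\beta}\exp\left(-\frac{2nt^2}{\beta}+\sum_{i=1}^{n-1}\left(\log\|K_i^\leftarrow\|_{\alpha\to\gamma_i^\star(\alpha)}-\frac{1}{\bar\gamma_i^\star(\alpha)}\min_{j\in\mathrm{supp}(P_i)}\log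 P_i(j)\right)\right).$$ Moreover, if the chain is time-homogeneous, $K_i=K$ for all $i$ (with $K^\leftarrow$ and $\gamma_K^\star(\alpha)$, $\bar\gamma_K^\star(\alpha)$ defined analogously), then $$\mathcal{P}_{X^n}\left(\left|f-\mathcal{P}_{\bigotimes_{i=1}^n X_i}(f)\right|\ge t\right)\le 2^{1/\beta}\exp\left(-\frac{2nt^2}{\beta}+(n-1)\log\|K^\leftarrow\|_{\alpha\to\gamma_K^\star(\alpha)}-\frac{1}{\bar\gamma_K^\star(\alpha)}\sum_{i=1}^{n-1}\min_{j\in\mathrm{supp}(P_i)}\log P_i(j)\right)$$ $$\le 2^{1/\beta}\exp\left(-\frac{2nt^2}{\beta}+(n-1)\log\|K^\leftarrow\|_{\alpha\to\gamma_K^\star(\alpha)}-\frac{n-1}{\bar\gamma_K^\star(\alpha)}\min_{i=1,\ldots,n-1}\min_{j\in\mathrm{supp}(P_i)}\log P_i(j)\right).$$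
   Context: $\mathcal{P}_{X^n}$ is the joint law of $(X_1,\ldots,X_n)$ and $\mathcal{P}_{\bigotimes_{i=1}^n X_i}=P_1\otimes\cdots\otimes P_n$ the product of the marginals; $\mu(g)=\int g\,d\mu$. For a Markov kernel $K$, $(Kg)(x)=\sum_y K(y|x)g(y)$ and $\|K\|_{\alpha\to\gamma}=\sup_{g\ne0}\|Kg\|_\alpha/\|g\|_\gamma$.
   Formalization: In the time-homogeneous part the backward channel of K still depends on P_i, so a single norm and a single γ_K^* are not defined in general; the bounds are stated under the assumption that γ_i^*(α) and the norms ‖K_i^←‖ take common values for all i ≤ n-1 (e.g. a stationary chain). *)

(* Defs.v *)
From HB Require Import structures.
From mathcomp Require Import all_boot all_order all_algebra.
From mathcomp Require Import all_classical all_reals all_analysis.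
Set Implicit Arguments. Unset Strict Implicit. Unset Printing Implicit Defensive.
Import Order.TTheory GRing.Theory Num.Theory.
Local Open Scope classical_set_scope.
Local Open Scope ring_scope.

(* Conventions (0-based indexing):
   the chain is X_0, ..., X_{n-1}; X_0 ~ P1;  K i x y = K_i(y|x) is the
   transition kernel from X_i to X_{i+1};  marg P1 K i = pmf of X_i.
   A kernel Q : T -> T -> R acts on functions by (Q g)(x) = \sum_y Q x y g y. *)

Section Defs.
Variables (R : realType) (T : finType).

Definition is_pmf (P : T -> R) : Prop :=
  (forall x, 0 <= P x) /\ \sum_x P x = 1.

Definition is_stoch (Q : T -> T -> R) : Prop :=
  (forall x y, 0 <= Q x y) /\ (forall x, \sum_y Q x y = 1).

Definition step (P : T -> R) (Q : T -> T -> R) : T -> R :=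
  fun y => \sum_x P x * Q x y.

Fixpoint marg (P1 : T -> R) (K : nat -> T -> T -> R) (i : nat) : T -> R :=
  match i with 0 => P1 | j.+1 => step (marg P1 K j) (K j) end.

Definition apply_ker (Q : T -> T -> R) (g : T -> R) : T -> R :=
  fun x => \sum_y Q x y * g y.

Definition lpnorm (P : T -> R) (a : R) (g : T -> R) : R :=
  (\sum_x P x * (`|g x| `^ a)) `^ a^-1.

Definition opnorm (Q : T -> T -> R) (Pin Pout : T -> R) (a c : R) : R :=
  sup [set r | exists g : T -> R, 0 < lpnorm Pin c g /\
               r = lpnorm Pout a (apply_ker Q g) / lpnorm Pin c g].

Definition bwd (P : T -> R) (Q : T -> T -> R) : T -> T -> R :=
  fun y x => Q x y * P x / step P Q y.

(* gamma^*(a): smallest c in [1,a] with ||Q||_{a -> c} <= 1, where Q maps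
   L^c(P Q) to L^a(P). *)
Definition gamma_star (P : T -> R) (Q : T -> T -> R) (a : R) : R :=
  inf [set c | 1 <= c <= a /\ opnorm Q (step P Q) P a c <= 1].

Definition minlog (P : T -> R) : R :=
  inf [set ln (P j) | j in [set j | 0 < P j]].

Variable n : nat.

Definition joint (P1 : T -> R) (K : nat -> T -> T -> R) (x : {ffun 'I_n -> T}) : R :=
  (\prod_(i < n | val i == 0%N) P1 (x i)) *
  \prod_(i < n) \prod_(j < n | val j == (val i).+1) K i (x i) (x j).

Definition prodlaw (P1 : T -> R) (K : nat -> T -> T -> R) (x : {ffun 'I_n -> T}) : R :=
  \prod_(i < n) marg P1 K i (x i).

Definition expect (mu : {ffun 'I_n -> T} -> R) (f : {ffun 'I_n -> T} -> R) : R :=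
  \sum_x mu x * f x.

Definition prob (mu : {ffun 'I_n -> T} -> R) (E : {ffun 'I_n -> T} -> bool) : R :=
  \sum_(x | E x) mu x.

Definition upd (x : {ffun 'I_n -> T}) (i : 'I_n) (y : T) : {ffun 'I_n -> T} :=
  [ffun j => if j == i then y else x j].

Definition bounded_diff (f : {ffun 'I_n -> T} -> R) : Prop :=
  forall x i y, `|f x - f (upd x i y)| <= n%:R^-1.

End Defs.

(* Main.v *)
Require Import Defs.
From HB Require Import structures.
From mathcomp Require Import all_boot all_order all_algebra.
From mathcomp Require Import all_classical all_reals all_analysis.
From mathcomp Require Import ring lra.
Import Order.TTheory GRing.Theory Num.Theory.
Import numFieldNormedType.Exports.
Local Open Scope classical_set_scope.
Local Open Scope ring_scope.

(* The joint law has density D = prod_i L_i(x_i, x_{i+1}) with respect to the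
   product Q of the marginals, where L_i(x, y) = K_i(y|x) / P_{i+1}(y).
   Hoelder gives P(E) <= ||D||_{L^alpha(Q)} Q(E)^{1/beta}, and McDiarmid's
   inequality bounds Q(E) by 2 exp(- 2 n t^2).  As L_i(x, .) is the image under
   K_i^<- of the indicator of x, divided by P_i(x), its L^alpha(P_{i+1}) norm is
   at most ||K_i^<-||_{alpha -> gamma} P_i(x)^{1/gamma - 1}, uniformly in x;
   integrating out X_n, X_{n-1}, ... in turn multiplies these bounds.  Only
   gamma >= 1 matters, and gamma_star is in [1, alpha] because K_i is a
   contraction from L^alpha(P_{i+1}) to L^alpha(P_i). *)

(** * Hoeffding's lemma on a finite space *)

Lemma is_derive_ge0_le (R : realType) (F F' : R -> R) (u : R) :
  (forall x : R, is_derive x 1 F (F' x)) -> (forall x, 0 <= x -> 0 <= F' x) ->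
  0 <= u -> F 0 <= F u.
Proof.
move=> dF F'0 u0.
apply: (@ger0_derive1_ndecr R F 0 u) => //.
- move=> x; rewrite in_itv/= => /andP[x0 _].
  by rewrite derive1E derive_val F'0// ltW.
- apply: continuous_subspaceT => x.
  by apply: differentiable_continuous; apply/derivable1_diffP.
Qed.

(** The difference [h] of the two exponents, right minus left, satisfies h(0) = h'(0) = 0 and h'' =
    1/4 - q (1 - q) = (q - 1/2)^2 >= 0, where q = p e^x / G(x) is the tilted weight. Integrating the
    sign twice gives h >= 0 on the half-line. *)
Lemma two_point_mgf_le (R : realType) (p u : R) : 0 <= p <= 1 -> 0 <= u ->
  1 - p + p * expR u <= expR (p * u + u ^+ 2 / 8).
Proof.
move=> /andP[p0 p1] u0.
pose G (x : R) : R := 1 - p + p * expR x.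
have Ggt0 x : 0 < G x.
  rewrite /G; have := expR_gt0 x; move: p0.
  rewrite le_eqVlt => /predU1P[<-|p0] e0.
    by lra.
  by have : 0 < p * expR x by [exact: mulr_gt0]; lra.
have dG (x : R) : is_derive x 1 G (p * expR x).
  by apply: is_derive_eq; rewrite /GRing.scale/=; ring.
pose h' (x : R) : R := p + x / 4 - p * expR x / G x.
pose h (x : R) : R := p * x + x ^+ 2 / 8 - ln (G x).
have dlnG (x : R) : is_derive x 1 (fun y => ln (G y)) (p * expR x / G x).
  have := is_derive1_comp (is_derive1_ln (Ggt0 x)) (dG x).
  by rewrite mulrC.
have dh (x : R) : is_derive x 1 h (h' x).
  apply: is_derive_eq; rewrite /h' /GRing.scale/=; field.
  by rewrite gt_eqF.
pose h'' (x : R) : R := 4^-1 - p * expR x / G x * (1 - p * expR x / G x).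
have dh' (x : R) : is_derive x 1 h' (h'' x).
  have GV := is_deriveV (lt0r_neq0 (Ggt0 x)) (dG x).
  apply: is_derive_eq; rewrite /h'' /GRing.scale/=; field.
  by rewrite gt_eqF.
have h'_ge0 x : 0 <= x -> 0 <= h' x.
  move=> x0; have -> : 0 = h' 0.
    by rewrite /h' /G expR0 mulr1 subrK divr1 mul0r addr0 subrr.
  apply: (@is_derive_ge0_le _ h' h'') => // y _.
  rewrite /h''; set q := _ / _; have := sqr_ge0 (q - 2^-1); lra.
have := @is_derive_ge0_le _ h h' u dh h'_ge0 u0.
rewrite /h {1}/G expR0 mulr1 subrK ln1 mulr0 expr0n/= mul0r addr0 subr0 subr_ge0.
by move=> hu; rewrite -[leLHS]/(G u) -[leLHS](@lnK _ (G u)) ?posrE// ler_expR.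
Qed.

(** Convexity from tangent lines: the tangent at [z] lies below the exponential at [a] and at [b];
    weighting these two inequalities by b - z and z - a cancels the slope. *)
Lemma expR_le_chord (R : realType) (a b z : R) : a < b -> a <= z <= b ->
  expR z <= expR a + (z - a) / (b - a) * (expR b - expR a).
Proof.
move=> ab /andP[az zb]; have ba : 0 < b - a by rewrite subr_gt0.
have tan v : expR z * (1 + (v - z)) <= expR v.
  by rewrite -[X in _ <= expR X](addrNK z v) expRD mulrC ler_pM2r ?expR_gt0//
    expR_ge1Dx.
have ta := ler_wpM2l (_ : 0 <= b - z) (tan a).
have tb := ler_wpM2l (_ : 0 <= z - a) (tan b).
rewrite !subr_ge0 in ta tb; move: (ta zb) (tb az) => {}ta {}tb.
rewrite -(ler_pM2l ba).
have -> : (b - a) * (expR a + (z - a) / (b - a) * (expR b - expR a)) =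
  (b - z) * expR a + (z - a) * expR b by field; rewrite gt_eqF.
lra.
Qed.

Lemma is_pmf_inhabited (R : realType) (T : finType) (w : T -> R) :
  is_pmf w -> inhabited T.
Proof.
case=> _ w1; case: (pickP (@predT T)) => [x _|T0]; first by split.
by move: w1; rewrite big_pred0// => /esym/eqP; rewrite oner_eq0.
Qed.

(** The chord between the extreme values of [h] replaces the law of [h] by a two-point law on these
    values with the same mean, which reduces the claim to [two_point_mgf_le]. *)
Lemma hoeffding_mgf_le (R : realType) (T : finType) (w h : T -> R) (c : R) :
  is_pmf w -> (forall x y, h x - h y <= c) ->
  \sum_x w x * expR (h x) <= expR (\sum_x w x * h x + c ^+ 2 / 8).
Proof.
move=> pw hc; have [x0] := is_pmf_inhabited _ _ _ pw; case: pw => w0 w1.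
pose xa := [arg min_(x < x0) h x]%O; pose xb := [arg max_(x > x0) h x]%O.
have ha x : h xa <= h x by rewrite /xa; case: arg_minP => // i _; apply.
have hb x : h x <= h xb by rewrite /xb; case: arg_maxP => // i _; apply.
set a := h xa in ha *; set b := h xb in hb *.
set m := \sum_x w x * h x.
have mean (v : R) : \sum_x w x * v = v by rewrite -mulr_suml w1 mul1r.
have am : a <= m by rewrite -[a]mean; apply: ler_sum => x _; rewrite ler_wpM2l.
have mb : m <= b by rewrite -[b]mean; apply: ler_sum => x _; rewrite ler_wpM2l.
(* If min and max coincide, [h] is constant and no chord is available; this case is settled
   directly. *)
have := le_trans am mb; rewrite le_eqVlt => /predU1P[ab|ab].
  have hm x : h x = m.
    by apply/le_anti; rewrite (le_trans (hb x)) -?ab// (le_trans mb) -?ab.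
  under eq_bigr do rewrite hm; rewrite mean ler_expR lerDl.
  by rewrite divr_ge0// sqr_ge0.
have ba : 0 < b - a by rewrite subr_gt0.
pose p := (m - a) / (b - a).
have -> : m = a + p * (b - a) by rewrite /p; field; rewrite gt_eqF.
have le1 : \sum_x w x * expR (h x) <= expR a * (1 - p + p * expR (b - a)).
  have -> : expR a * (1 - p + p * expR (b - a)) =
      \sum_x w x * (expR a + (h x - a) / (b - a) * (expR b - expR a)).
    rewrite (eq_bigr (fun x => w x * (expR a - a / (b - a) * (expR b - expR a))
        + w x * h x * ((b - a)^-1 * (expR b - expR a)))); last first.
      by move=> x _; ring.
    rewrite big_split/= mean -mulr_suml -/m /p.
    have -> : expR b = expR (b - a) * expR a by rewrite -expRD addrNK.
    field.
    by rewrite gt_eqF.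
  apply: ler_sum => x _; rewrite ler_wpM2l//.
  by apply: expR_le_chord => //; rewrite ha hb.
apply: (le_trans le1); rewrite -[in leRHS]addrA [leRHS]expRD ler_pM2l ?expR_gt0//.
have p01 : 0 <= p <= 1.
  apply/andP; split; first by rewrite /p divr_ge0// ?(ltW ba)// subr_ge0.
  by rewrite /p ler_pdivrMr// mul1r lerD2r.
apply: le_trans (two_point_mgf_le _ _ _ p01 (ltW ba)) _.
rewrite ler_expR lerD2l ler_pM2r ?invr_gt0// lerXn2r ?nnegrE ?(ltW ba)//.
  by apply: le_trans (ltW ba) _; exact: hc.
exact: hc.
Qed.

(** * McDiarmid's inequality for product laws *)

Section product_law.
Context {R : realType} {T : finType} {n : nat}.
Implicit Types (p : 'I_n -> T -> R) (g : {ffun 'I_n -> T} -> R).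
Implicit Types (x z : {ffun 'I_n -> T}) (i j : 'I_n) (c t : R) (s : seq 'I_n).

(** Arbitrary factors instead of the marginals of a chain; [prodlaw P1 K] is the instance
    [p i := marg P1 K i], by conversion. *)
Definition prodm p x : R := \prod_i p i (x i).

(** Conditional expectation of [g] given all coordinates but the [i]-th, kept as a function of the
    full point so that it can be iterated. *)
Definition avg p i g x : R := \sum_y p i y * g (upd x i y).

Lemma updK x i y : upd (upd x i y) i (x i) = x.
Proof. by apply/ffunP => j; rewrite !ffunE; case: eqP => [->|]. Qed.

Lemma upd_upd x i y y' : upd (upd x i y') i y = upd x i y.
Proof. by apply/ffunP => j; rewrite !ffunE; case: eqP. Qed.

Lemma updC x i j y y' : i != j -> upd (upd x i y) j y' = upd (upd x j y') i y.
Proof.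
move=> ij; apply/ffunP => k; rewrite !ffunE.
by have [->|//] := eqVneq k j; rewrite eq_sym (negPf ij).
Qed.

Lemma sum_prodm p : (forall i, is_pmf (p i)) -> \sum_x prodm p x = 1.
Proof.
move=> pp; rewrite /prodm -(bigA_distr_bigA (fun i y => p i y)).
by rewrite big1// => i _; case: (pp i).
Qed.

Lemma prodm_ge0 p x : (forall i, is_pmf (p i)) -> 0 <= prodm p x.
Proof. by move=> pp; apply: prodr_ge0 => i _; case: (pp i). Qed.

Lemma prodm_upd p x i y : prodm p (upd x i y) * p i (x i) = prodm p x * p i y.
Proof.
rewrite /prodm (bigD1 i)//= [in RHS](bigD1 i)//= ffunE eqxx.
rewrite (eq_bigr (fun j => p j (x j))); first by ring.
by move=> j ji; rewrite ffunE (negPf ji).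
Qed.

(* (x, y) |-> (upd x i y, x i) is an involution preserving the law of (X, Y),
   with Y an independent copy of X_i. *)
Lemma expect_avg p i g : is_pmf (p i) ->
  expect (prodm p) (avg p i g) = expect (prodm p) g.
Proof.
case=> _ p1; rewrite /expect /avg.
under eq_bigr do rewrite mulr_sumr.
rewrite pair_bigA/=.
pose swap (u : {ffun 'I_n -> T} * T) := (upd u.1 i u.2, u.1 i).
have swapK : involutive swap.
  by move=> [x y]; rewrite /swap/= updK ffunE eqxx.
rewrite (reindex_inj (inv_inj swapK))/=.
rewrite (eq_bigr (fun u => prodm p u.1 * g u.1 * p i u.2)); last first.
  by move=> [x y] _/=; rewrite updK mulrA prodm_upd; ring.
rewrite -(pair_bigA _ (fun x y => prodm p x * g x * p i y))/=.
by apply: eq_bigr => x _; rewrite -mulr_sumr p1 mulr1.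
Qed.

Lemma avg_bounded_diff p i g c : is_pmf (p i) -> 0 <= c ->
  (forall x j y, `|g x - g (upd x j y)| <= c) ->
  forall x j y, `|avg p i g x - avg p i g (upd x j y)| <= c.
Proof.
move=> [p0 p1] c0 gc x j y; rewrite /avg -sumrB.
have [<-|ij] := eqVneq i j.
  by rewrite big1 ?normr0// => y' _; rewrite upd_upd subrr.
apply: le_trans (ler_norm_sum _ _ _) _.
rewrite -[c]mul1r -p1 mulr_suml; apply: ler_sum => y' _.
by rewrite -mulrBr normrM ger0_norm// ler_wpM2l// -updC.
Qed.

(** Hoeffding's lemma for y |-> g (upd x i y): two points of this section differ by a single update,
    so its range has width at most [c]. *)
Lemma avg_mgf_le p i g c x : is_pmf (p i) ->
  (forall x j y, `|g x - g (upd x j y)| <= c) ->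
  avg p i (expR \o g) x <= expR (c ^+ 2 / 8) * expR (avg p i g x).
Proof.
move=> pp gc; rewrite -expRD addrC; apply: hoeffding_mgf_le => // y y'.
apply: le_trans (ler_norm _) _; rewrite -(upd_upd x i y' y).
exact: gc.
Qed.

(** These successive averages take the place of the Doob martingale. *)
Definition avgs p g s := foldr (avg p) g s.

Lemma expect_avgs p g s : (forall i, is_pmf (p i)) ->
  expect (prodm p) (avgs p g s) = expect (prodm p) g.
Proof. by move=> pp; elim: s => //= i s IH; rewrite expect_avg. Qed.

Lemma avgs_bounded_diff p g c s : (forall i, is_pmf (p i)) ->
  0 <= c -> (forall x j y, `|g x - g (upd x j y)| <= c) ->
  forall x j y, `|avgs p g s x - avgs p g s (upd x j y)| <= c.
Proof. by move=> pp c0 gc; elim: s => //= i s IH; exact: avg_bounded_diff. Qed.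

Lemma avgs_upd p g (s : seq 'I_n) i y x : i \in s ->
  avgs p g s (upd x i y) = avgs p g s x.
Proof.
elim: s x => //= j s IH x; rewrite inE /avg.
have [-> _|ij /= js] := eqVneq i j.
  by apply: eq_bigr => y' _; rewrite upd_upd.
by apply: eq_bigr => y' _; rewrite updC// IH.
Qed.

(** Each further averaged coordinate costs one Hoeffding factor exp(c^2 / 8): averaging preserves
    both the expectation and the bounded differences, so [avg_mgf_le] applies again. *)
Lemma avgs_mgf_le p g c s : (forall i, is_pmf (p i)) ->
  0 <= c -> (forall x j y, `|g x - g (upd x j y)| <= c) ->
  expect (prodm p) (expR \o g) <=
  expR ((size s)%:R * (c ^+ 2 / 8)) * expect (prodm p) (expR \o avgs p g s).
Proof.
move=> pp c0 gc; elim: s => [|i s IH]; first by rewrite mul0r expR0 mul1r.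
apply: (le_trans IH); rewrite -[size (i :: s)]/(size s).+1.
rewrite -[(size s).+1%:R]natr1 mulrDl mul1r expRD -mulrA.
rewrite ler_pM2l ?expR_gt0// -(expect_avg _ i (expR \o avgs _ _ _))//.
rewrite /expect mulr_sumr; apply: ler_sum => x _.
rewrite mulrCA ler_wpM2l ?prodm_ge0//.
by apply: avg_mgf_le => //; exact: avgs_bounded_diff.
Qed.

(** The point [x] is turned into [z] one coordinate at a time. *)
Lemma upd_invariant_const g : (forall x i y, g (upd x i y) = g x) ->
  forall x z, g x = g z.
Proof.
move=> gi x z.
pose merge s := foldr (fun i u => upd u i (z i)) x s.
have gm s : g (merge s) = g x by elim: s => //= i s <-; rewrite gi.
rewrite -(gm (enum 'I_n)); congr g; apply/ffunP => j.
have mj s : merge s j = if j \in s then z j else x j.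
  by elim: s => //= i s IH; rewrite ffunE inE IH; case: eqVneq => [->|].
by rewrite mj mem_enum.
Qed.

(** Once every coordinate has been averaged, the function is constant, hence equal to the mean of
    [g]. *)
Lemma bounded_diff_mgf_le p g c : (forall i, is_pmf (p i)) ->
  0 <= c -> (forall x j y, `|g x - g (upd x j y)| <= c) ->
  expect (prodm p) (expR \o g) <=
  expR (n%:R * (c ^+ 2 / 8) + expect (prodm p) g).
Proof.
move=> pp c0 gc; have := avgs_mgf_le _ _ _ (enum 'I_n) pp c0 gc.
rewrite -cardE card_ord => /le_trans; apply.
rewrite expRD ler_pM2l ?expR_gt0//.
set h := avgs _ _ _.
have hE x : h x = expect (prodm p) g.
  have hc : forall x z, h x = h z.
    by apply: upd_invariant_const => z i y; rewrite /h avgs_upd// mem_enum.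
  rewrite -(expect_avgs _ _ (enum 'I_n) pp) -/h /expect.
  under eq_bigr do rewrite (hc _ x).
  by rewrite -mulr_suml sum_prodm// mul1r.
rewrite {1}/expect; under eq_bigr do rewrite /= hE.
by rewrite -mulr_suml sum_prodm// mul1r.
Qed.

Lemma expectZ (mu : {ffun 'I_n -> T} -> R) g c :
  expect mu (fun x => c * g x) = c * expect mu g.
Proof. by rewrite /expect mulr_sumr; apply: eq_bigr => x _; rewrite mulrCA. Qed.

Lemma mcdiarmid_upper p g t : (0 < n)%N -> (forall i, is_pmf (p i)) ->
  bounded_diff g -> 0 < t ->
  prob (prodm p) (fun x => t <= g x - expect (prodm p) g) <=
  expR (- (2 * n%:R * t ^+ 2)).
Proof.
move=> n0 pp gbd t0; set m := expect _ g.
have nR : 0 < n%:R :> R by rewrite ltr0n.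
(* the minimizer of s |-> - s t + s^2 / (8 n) *)
pose s : R := 4 * n%:R * t.
have s0 : 0 < s by rewrite /s !mulr_gt0.
have mgf : expect (prodm p) (expR \o (fun x => s * g x)) <=
    expR (n%:R * ((s / n%:R) ^+ 2 / 8) + s * m).
  rewrite -expectZ; apply: bounded_diff_mgf_le => //.
    by rewrite divr_ge0// ltW.
  by move=> x j y; rewrite -mulrBr normrM gtr0_norm// ler_pM2l.
apply: (@le_trans _ _ (expR (- s * (t + m)) *
    expect (prodm p) (expR \o (fun x => s * g x)))); last first.
  apply: le_trans (ler_wpM2l (expR_ge0 _) mgf) _.
  rewrite -expRD ler_expR le_eqVlt; apply/orP; left; apply/eqP.
  by rewrite /s; field; rewrite gt_eqF.
(* Markov's inequality by hand: on the event the factor exp(s (g - m - t)) is at least 1, and off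
   the event the terms are nonnegative. *)
rewrite /expect mulr_sumr /prob [leRHS](bigID (fun x => t <= g x - m))/=.
rewrite -[leLHS]addr0 lerD//; last first.
  by apply: sumr_ge0 => x _; rewrite !mulr_ge0 ?expR_ge0 ?prodm_ge0.
apply: ler_sum => x tx; rewrite mulrCA ler_peMr ?prodm_ge0//.
rewrite -expRD -expR0 ler_expR.
have : 0 <= s * (g x - m - t) by rewrite pmulr_rge0// subr_ge0.
lra.
Qed.

Lemma mcdiarmid p g t : (0 < n)%N -> (forall i, is_pmf (p i)) ->
  bounded_diff g -> 0 < t ->
  prob (prodm p) (fun x => t <= `|g x - expect (prodm p) g|) <=
  2 * expR (- (2 * n%:R * t ^+ 2)).
Proof.
move=> n0 pp gbd t0; set m := expect _ g.
(* The lower tail is the upper tail of -g, written with the factor -1 so that [expectZ] computes its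
   mean. *)
have Ngbd : bounded_diff (fun x => -1 * g x).
  by move=> x i y; rewrite -mulrBr normrM normrN1 mul1r; exact: gbd.
have up := mcdiarmid_upper _ _ _ n0 pp gbd t0.
have lo := mcdiarmid_upper _ _ _ n0 pp Ngbd t0.
rewrite expectZ -/m in lo.
rewrite mulrDl mul1r; apply: le_trans (lerD up lo).
rewrite /prob big_mkcond [X in _ <= X + _]big_mkcond.
rewrite [X in _ <= _ + X]big_mkcond -big_split/=; apply: ler_sum => x _ /=.
rewrite -/m; have W0 := prodm_ge0 _ x pp.
have -> : (t <= `|g x - m|) = (t <= g x - m) || (t <= -1 * g x - -1 * m).
  by rewrite ler_normr; congr (_ || (_ <= _)); ring.
case: (t <= g x - m) => /=; last by rewrite add0r.
by rewrite lerDl; case: ifP.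
Qed.

End product_law.

(** * Jensen and Hölder inequalities, weighted norms and kernels *)

Lemma jensen_powR (R : realType) (I : finType) (E : pred I) (w a : I -> R)
    (r : R) : 1 < r -> (forall i, 0 <= w i) -> (forall i, 0 <= a i) ->
  (\sum_(i | E i) w i * a i) `^ r <=
  (\sum_(i | E i) w i) `^ (r - 1) * \sum_(i | E i) w i * a i `^ r.
Proof.
move=> r1 w0 a0; have r0 : 0 < r by lra.
have rN0 : r != 0 by rewrite gt_eqF.
set S := \sum_(i | E i) w i * a i; set W := \sum_(i | E i) w i.
set M := \sum_(i | E i) w i * a i `^ r.
have S0 : 0 <= S by apply: sumr_ge0 => i _; rewrite mulr_ge0.
have M0 : 0 <= M by apply: sumr_ge0 => i _; rewrite mulr_ge0// powR_ge0.
have : 0 <= W by exact: sumr_ge0.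
rewrite le_eqVlt => /predU1P[/esym W0|W0].
  have wE i : E i -> w i = 0 by apply: (psumr_eq0P _ W0) => j _.
  have -> : S = 0 by rewrite /S big1// => i /wE ->; rewrite mul0r.
  by rewrite powR0// mulr_ge0// powR_ge0.
(* Young's inequality with conjugate exponents r and q is applied to each a_i and m^(r-1), where [m]
   is the weighted mean. Summing gives W m^r <= M / r + W m^r / q, that is W m^r <= M; finally S^r =
   W^(r-1) (W m^r). *)
pose m := S / W; pose q := r / (r - 1).
have m0 : 0 <= m by rewrite divr_ge0// ltW.
have SE : S = W * m by rewrite /m; field; rewrite gt_eqF.
have q0 : 0 < q by rewrite divr_gt0// subr_gt0.
have rq : r^-1 + q^-1 = 1 by rewrite /q; field; rewrite rN0 gt_eqF//; lra.
have mq : (m `^ (r - 1)) `^ q = m `^ r.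
  by rewrite -powRrM; congr (_ `^ _); rewrite /q; field; rewrite gt_eqF//; lra.
have young : S * m `^ (r - 1) <= M / r + W * (m `^ r / q).
  rewrite /S /M /W !mulr_suml -big_split/=; apply: ler_sum => i _.
  have := conjugate_powR (a0 i) (powR_ge0 m (r - 1)) r0 q0 rq.
  by rewrite mq => /(ler_wpM2l (w0 i)); rewrite mulrDr !mulrA.
have WmM : W * m `^ r <= M.
  move: young; rewrite {1}SE -mulrA mulr_powRB1//.
  have -> : q^-1 = 1 - r^-1 by rewrite -rq addrAC subrr add0r.
  by move=> le; rewrite -(@ler_pM2r _ r^-1) ?invr_gt0//; lra.
rewrite SE powRM// ?(ltW W0)// -(mulr_powRB1 (ltW W0) r0).
by rewrite -mulrA mulrCA ler_wpM2l// powR_ge0.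
Qed.

Section norms.
Context {R : realType} {T : finType}.
Implicit Types (P : T -> R) (Q : T -> T -> R) (g h : T -> R) (a c : R).

Lemma step_is_pmf P Q : is_pmf P -> is_stoch Q -> is_pmf (step P Q).
Proof.
move=> [P0 P1] [Q0 Q1]; split=> [y|].
  by apply: sumr_ge0 => x _; rewrite mulr_ge0.
rewrite /step exchange_big/= -[RHS]P1; apply: eq_bigr => x _.
by rewrite -mulr_sumr Q1 mulr1.
Qed.

Lemma step_le P Q x y : is_pmf P -> is_stoch Q -> P x * Q x y <= step P Q y.
Proof.
move=> [P0 _] [Q0 _]; rewrite /step (bigD1 x)//= lerDl.
by apply: sumr_ge0 => z _; rewrite mulr_ge0.
Qed.

Lemma lpnorm_le P a g h : (forall x, 0 <= P x) -> 0 < a ->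
  (forall x, `|g x| <= `|h x|) -> lpnorm P a g <= lpnorm P a h.
Proof.
move=> P0 a0 gh; rewrite /lpnorm.
have s0 (k : T -> R) : \sum_x P x * `|k x| `^ a \in Num.nneg.
  by rewrite nnegrE sumr_ge0// => x _; rewrite mulr_ge0// powR_ge0.
apply: ge0_ler_powR => //; first by rewrite invr_ge0 ltW.
apply: ler_sum => x _; rewrite ler_wpM2l//.
by apply: ge0_ler_powR; rewrite ?nnegrE// ltW.
Qed.

Lemma lpnormZ P a (k : R) g : (forall x, 0 <= P x) -> 0 < a ->
  lpnorm P a (fun x => k * g x) = `|k| * lpnorm P a g.
Proof.
move=> P0 a0; rewrite /lpnorm.
have -> : \sum_x P x * `|k * g x| `^ a = `|k| `^ a * \sum_x P x * `|g x| `^ a.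
  rewrite mulr_sumr; apply: eq_bigr => x _.
  by rewrite normrM powRM// mulrCA.
rewrite powRM ?powR_ge0//; last first.
  by apply: sumr_ge0 => x _; rewrite mulr_ge0// powR_ge0.
by rewrite -powRrM mulfV ?gt_eqF// powRr1.
Qed.

Lemma lpnorm_delta P a (z : T) : 0 < a ->
  lpnorm P a (fun x => (x == z)%:R) = P z `^ a^-1.
Proof.
move=> a0; rewrite /lpnorm (bigD1 z)//= eqxx normr1 powR1 mulr1.
rewrite big1 ?addr0// => x /negPf ->.
by rewrite normr0 powR0 ?mulr0// gt_eqF.
Qed.

(** Jensen in each row of [Q], then integration against [P]. *)
Lemma apply_ker_contract P Q a g : is_pmf P -> is_stoch Q -> 1 < a ->
  lpnorm P a (apply_ker Q g) <= lpnorm (step P Q) a g.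
Proof.
move=> pP sQ a1; have pPQ := step_is_pmf _ _ pP sQ.
case: pP sQ => [P0 P1] [Q0 Q1].
have a0 : 0 <= a by lra.
apply: ge0_ler_powR; first by rewrite invr_ge0.
- by rewrite nnegrE sumr_ge0// => x _; rewrite mulr_ge0// powR_ge0.
- by rewrite nnegrE sumr_ge0// => x _; rewrite mulr_ge0 ?powR_ge0//; case: pPQ.
have -> : \sum_y step P Q y * `|g y| `^ a =
    \sum_x P x * \sum_y Q x y * `|g y| `^ a.
  rewrite /step; under eq_bigr do rewrite mulr_suml.
  rewrite exchange_big/=; apply: eq_bigr => x _; rewrite mulr_sumr.
  by apply: eq_bigr => y _; rewrite mulrA.
apply: ler_sum => x _; rewrite ler_wpM2l//.
have := @jensen_powR R T predT (Q x) (fun y => `|g y|) a a1 (Q0 x)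
  (fun y => normr_ge0 (g y)).
rewrite Q1 powR1 mul1r; apply: le_trans.
apply: ge0_ler_powR; rewrite ?nnegrE//.
  by apply: sumr_ge0 => y _; rewrite mulr_ge0.
apply: le_trans (ler_norm_sum _ _ _) _; apply: ler_sum => y _.
by rewrite normrM ger0_norm.
Qed.

(** By contraction, the exponent [a] itself is admissible, so the infimum runs over a nonempty set
    bounded below by 1. *)
Lemma gamma_star_itv P Q a : is_pmf P -> is_stoch Q -> 1 < a ->
  1 <= gamma_star P Q a <= a.
Proof.
move=> pP sQ a1; rewrite /gamma_star; set A := [set c | _].
have Aa : A a.
  split; first by rewrite lexx (ltW a1).
  rewrite /opnorm; set B := [set r | _].
  have [B0|/set0P B0] := eqVneq B set0; first by rewrite B0 sup0.
  apply: ge_sup => // r [g [g0 ->]].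
  by rewrite ler_pdivrMr// mul1r apply_ker_contract.
have Alb : lbound A 1 by move=> c -[/andP[c1 _] _]; exact: c1.
apply/andP; split; first by apply: lb_le_inf => //; exists a.
by apply: ge_inf => //; exists 1.
Qed.

Lemma norm_le_lpnorm P c g x : (forall x, 0 <= P x) -> 0 < c -> 0 < P x ->
  `|g x| <= lpnorm P c g / P x `^ c^-1.
Proof.
move=> P0 c0 Px; rewrite ler_pdivlMr ?powR_gt0//.
rewrite -[`|g x|](powRr1 (normr_ge0 _)) -[X in `|g x| `^ X](@mulfV _ c) ?gt_eqF//.
rewrite powRrM -powRM ?powR_ge0//.
apply: ge0_ler_powR; rewrite ?invr_ge0 ?nnegrE ?mulr_ge0 ?powR_ge0 ?(ltW c0)//.
  by apply: sumr_ge0 => y _; rewrite mulr_ge0// powR_ge0.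
rewrite (bigD1 x)//= mulrC lerDl.
by apply: sumr_ge0 => y _; rewrite mulr_ge0// powR_ge0.
Qed.

(** The supremum in [opnorm] dominates its ratios only once they are known to be bounded above;
    finiteness of the state space provides the bound. *)
Lemma le_opnorm_bwd P Q a c g : is_pmf P -> is_stoch Q -> 0 < a -> 0 < c ->
  0 < lpnorm P c g ->
  lpnorm (step P Q) a (apply_ker (bwd P Q) g) <=
  opnorm (bwd P Q) P (step P Q) a c * lpnorm P c g.
Proof.
move=> pP sQ a0 c0 g0; have [S0 _] := step_is_pmf _ _ pP sQ.
have [P0 _] := pP; have [Q0 _] := sQ.
rewrite -ler_pdivrMr//; apply: ub_le_sup; last by exists g.
have bwd0 y x : 0 <= bwd P Q y x by rewrite /bwd !mulr_ge0// invr_ge0.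
(* By [norm_le_lpnorm], a function of unit norm is at most P(x)^(-1/c) at each x with P(x) > 0, so
   its image is at most [B]. Where P(x) = 0 the backward kernel vanishes. *)
pose B y := \sum_x bwd P Q y x / P x `^ c^-1.
have B0 y : 0 <= B y.
  by apply: sumr_ge0 => x _; rewrite mulr_ge0// invr_ge0 powR_ge0.
exists (lpnorm (step P Q) a B) => _ [h [h0 ->]].
rewrite ler_pdivrMr//.
have -> : lpnorm (step P Q) a B * lpnorm P c h =
    lpnorm (step P Q) a (fun y => lpnorm P c h * B y).
  by rewrite [RHS](lpnormZ _ _ _ _ S0 a0) (gtr0_norm h0); exact: mulrC.
apply: lpnorm_le => // y.
rewrite [leRHS](ger0_norm (mulr_ge0 (ltW h0) (B0 y))).
apply: le_trans (ler_norm_sum _ _ _) _; rewrite /B mulr_sumr.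
apply: ler_sum => x _; rewrite normrM ger0_norm// mulrCA.
have := P0 x; rewrite le_eqVlt => /predU1P[Px|Px].
  by rewrite /bwd -Px mulr0 !mul0r.
by rewrite ler_wpM2l// norm_le_lpnorm.
Qed.

Lemma has_lbound_fin_image (I : finType) (A : set I) (F : I -> R) :
  has_lbound [set F i | i in A].
Proof.
exists (- \sum_i `|F i|) => _ [i _ <-].
rewrite lerNl (bigD1 i)//= -normrN ler_wpDr ?ler_norm//.
exact: sumr_ge0.
Qed.

Lemma minlog_le P x : 0 < P x -> minlog P <= ln (P x).
Proof.
by move=> Px; apply: ge_inf; [exact: has_lbound_fin_image|exists x].
Qed.

(* The backward operator norm is tested on the indicator of [x]: its image is
   P(x) times the density K(x, .) / P'. *)
Lemma density_moment_le P Q a c x : is_pmf P -> is_stoch Q -> 0 < a ->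
  1 <= c -> 0 < P x ->
  \sum_y step P Q y * (Q x y / step P Q y) `^ a <=
  expR (ln (opnorm (bwd P Q) P (step P Q) a c) - (1 - c^-1) * minlog P) `^ a.
Proof.
move=> pP sQ a0 c1 Px; have [S0 _] := step_is_pmf _ _ pP sQ.
have [P0 _] := pP; have [Q0 _] := sQ.
have c0 : 0 < c by lra.
set N := opnorm _ _ _ _ _; set S := \sum_y _.
have S_ge0 : 0 <= S by apply: sumr_ge0 => y _; rewrite mulr_ge0// powR_ge0.
have norm_d := @lpnorm_delta P c x c0.
have d0 : 0 < lpnorm P c (fun z => (z == x)%:R) by rewrite norm_d powR_gt0.
have := le_opnorm_bwd _ Q a c _ pP sQ a0 c0 d0.
have -> : apply_ker (bwd P Q) (fun z => (z == x)%:R) =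
    (fun y => P x * (Q x y / step P Q y)).
  apply/funext => y; rewrite /apply_ker (bigD1 x)//= eqxx mulr1 big1 ?addr0.
    by rewrite /bwd mulrAC mulrC.
  by move=> z /negPf ->; rewrite mulr0.
rewrite lpnormZ// norm_d -/N gtr0_norm//.
have -> : lpnorm (step P Q) a (fun y => Q x y / step P Q y) = S `^ a^-1.
  congr (_ `^ _); apply: eq_bigr => y _; rewrite ger0_norm//.
  by rewrite mulr_ge0// invr_ge0.
rewrite mulrC -ler_pdivlMr// => SN.
have {}SN : S `^ a^-1 <= expR (ln N - (1 - c^-1) * minlog P).
  apply: (le_trans SN).
  have -> : N * P x `^ c^-1 / P x = N * expR (- (1 - c^-1) * ln (P x)).
    rewrite -mulrA; congr (_ * _).
    rewrite /powR gt_eqF// -{2}(@lnK _ (P x)) ?posrE// -expRN -expRD.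
    by congr expR; ring.
  (* Equality if N > 0; if N <= 0 the bound holds whatever the default value of [ln]. *)
  have NlnN : N <= expR (ln N).
    by have [N0|N0] := ltP 0 N; [rewrite lnK|exact: le_trans N0 (expR_ge0 _)].
  rewrite expRD; apply: le_trans (ler_wpM2r (expR_ge0 _) NlnN) _.
  rewrite ler_pM2l ?expR_gt0// ler_expR mulNr lerN2 ler_wpM2l ?minlog_le//.
  by rewrite subr_ge0 invf_le1.
rewrite -[S](powRr1 S_ge0) -[X in S `^ X](@mulVf _ a) ?gt_eqF// powRrM.
by apply: ge0_ler_powR; rewrite ?nnegrE ?powR_ge0 ?expR_ge0// ltW.
Qed.
End norms.

(** This is the [a]-th root of [jensen_powR] on [E], with (a - 1) / a as the inverse of the
    conjugate exponent; the moment of [D] is then enlarged to the whole space. *)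
Lemma sum_hoelder_pred (R : realType) (I : finType) (E : pred I) (w D : I -> R)
    (a : R) : 1 < a -> (forall i, 0 <= w i) -> (forall i, 0 <= D i) ->
  \sum_(i | E i) w i * D i <=
  (\sum_(i | E i) w i) `^ (a / (a - 1))^-1 * (\sum_i w i * D i `^ a) `^ a^-1.
Proof.
move=> a1 w0 D0; have a0 : 0 < a by lra.
have s0 : 0 <= \sum_(i | E i) w i by exact: sumr_ge0.
have wD0 i : 0 <= w i * D i `^ a by rewrite mulr_ge0// powR_ge0.
have wED : \sum_(i | E i) w i * D i `^ a <= \sum_i w i * D i `^ a.
  by rewrite [leRHS](bigID E)/= lerDl sumr_ge0.
have L0 : 0 <= \sum_(i | E i) w i * D i.
  by apply: sumr_ge0 => i _; rewrite mulr_ge0.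
rewrite -[leLHS](powRr1 L0) -[X in _ `^ X <= _](@mulfV _ a) ?gt_eqF// powRrM.
have -> : (a / (a - 1))^-1 = (a - 1) * a^-1 by rewrite invf_div.
rewrite powRrM -powRM ?powR_ge0 ?sumr_ge0//.
apply: ge0_ler_powR; rewrite ?invr_ge0 ?nnegrE ?powR_ge0 ?(ltW a0)//.
  by rewrite mulr_ge0 ?powR_ge0// sumr_ge0.
apply: (le_trans (jensen_powR _ _ _ _ _ _ a1 w0 D0)).
by rewrite ler_wpM2l// powR_ge0.
Qed.

(** * Density of the chain with respect to the product of its marginals *)

Section chain.
Context {R : realType} {T : finType}.
Variables (P1 : T -> R) (K : nat -> T -> T -> R).
Hypotheses (pP1 : is_pmf P1) (sK : forall i, is_stoch (K i)).
Local Notation P := (marg P1 K).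

Lemma marg_is_pmf i : is_pmf (P i).
Proof. by elim: i => //= i IH; exact: step_is_pmf. Qed.

Let P_ge0 i x : 0 <= P i x. Proof. by case: (marg_is_pmf i). Qed.
Let K_ge0 i x y : 0 <= K i x y. Proof. by case: (sK i). Qed.

(* density of (X_i, X_{i+1}) with respect to the product of its marginals *)
Definition step_density i x y : R := K i x y / P i.+1 y.

Lemma step_density_ge0 i x y : 0 <= step_density i x y.
Proof. by rewrite mulr_ge0// invr_ge0. Qed.

(** Used for absolute continuity: a path ending at a state of zero marginal mass has weight zero. *)
Lemma path_weight_le (x : nat -> T) k :
  P1 (x 0%N) * \prod_(i < k) K i (x i) (x i.+1) <= P k (x k).
Proof.
elim: k => [|k IH]; first by rewrite big_ord0 mulr1.
rewrite big_ord_recr/= mulrA.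
apply: le_trans (ler_wpM2r (K_ge0 _ _ _) IH) _.
by apply: step_le => //; exact: marg_is_pmf.
Qed.

Lemma path_weight_density (x : nat -> T) k :
  P1 (x 0%N) * \prod_(i < k) K i (x i) (x i.+1) =
  P1 (x 0%N) * \prod_(i < k) P i.+1 (x i.+1) *
  \prod_(i < k) step_density i (x i) (x i.+1).
Proof.
elim: k => [|k IH]; first by rewrite !big_ord0 !mulr1.
(* At a null state the quotient in [step_density] cannot be cancelled; there both sides are zero,
   the left one by [path_weight_le]. *)
have [Pk0|Pk0] := eqVneq (P k.+1 (x k.+1)) 0.
  rewrite [in RHS]big_ord_recr/= [X in _ * (_ * X)]Pk0 mulr0 mulr0 mul0r.
  apply/le_anti; rewrite -{1}Pk0 path_weight_le/=.
  by rewrite mulr_ge0 ?prodr_ge0//; case: pP1.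
rewrite 3!big_ord_recr mulrA IH /=.
have -> : K k (x k) (x k.+1) =
    step (P k) (K k) (x k.+1) * step_density k (x k) (x k.+1).
  by rewrite /step_density mulrC divfK.
by ring.
Qed.

Section fixed_length.
Variable m : nat.
Implicit Type x : {ffun 'I_m.+1 -> T}.

(** Truncated after [k] transitions, so that coordinates can be integrated out from the last one by
    induction on [k]; [inord] lets natural numbers index the point. *)
Definition density k x : R :=
  \prod_(i < k) step_density i (x (inord i)) (x (inord i.+1)).

Lemma density_ge0 k x : 0 <= density k x.
Proof. by apply: prodr_ge0 => i _; exact: step_density_ge0. Qed.

Lemma joint_density x : joint P1 K x = prodlaw P1 K x * density m x.
Proof.
have ord0E : inord 0 = ord0 :> 'I_m.+1 by apply/val_inj; rewrite /= inordK.
have -> : joint P1 K x =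
    P1 (x (inord 0)) * \prod_(i < m) K i (x (inord i)) (x (inord i.+1)).
  rewrite /joint ord0E; congr (_ * _).
    by rewrite (big_pred1 ord0)// => i; rewrite -val_eqE.
  (* The last coordinate has no successor, so its inner product in [joint] is empty. *)
  rewrite big_ord_recr/= [X in _ * X]big_pred0 ?mulr1; last first.
    by move=> j; apply/negbTE; rewrite neq_ltn ltn_ord.
  apply: eq_bigr => i _; rewrite (big_pred1 (inord i.+1)).
    by congr (K _ (x _) _); apply/val_inj; rewrite /= inordK// ltnS ltnW.
  by move=> j; rewrite [RHS]/= -[RHS]val_eqE/= inordK// ltnS.
rewrite (path_weight_density (fun i => x (inord i))) /density.
congr (_ * _); rewrite /prodlaw big_ord_recl ord0E; congr (_ * _).
apply: eq_bigr => i _; congr (P _ (x _)).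
by apply/val_inj; rewrite /= inordK// ltnS.
Qed.

Lemma density_upd k x y : (k < m)%N ->
  density k.+1 (upd x (inord k.+1) y) =
  density k x * step_density k (x (inord k)) y.
Proof.
move=> km; have inord_neq (i : nat) : (i <= k)%N ->
    (inord i == inord k.+1 :> 'I_m.+1) = false.
  move=> ik; rewrite -val_eqE/= !inordK ?ltn_eqF// ltnS//.
  exact: leq_trans ik (ltnW km).
rewrite /density big_ord_recr/= !ffunE eqxx inord_neq//; congr (_ * _).
apply: eq_bigr => i _; rewrite !ffunE !inord_neq//.
exact: ltnW.
Qed.

(** Averaging over coordinate k + 1 only touches the last factor of the density, whose moment is
    bounded uniformly in the previous state; what remains is the density truncated one step
    earlier. *)
Lemma density_moment (a : R) (C : nat -> R) k : 0 < a -> (k <= m)%N ->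
  (forall i (x : T), (i < m)%N -> 0 < P i x ->
     \sum_y P i.+1 y * step_density i x y `^ a <= C i `^ a) ->
  expect (prodlaw P1 K) (fun x => density k x `^ a) <=
  \prod_(i < k) C i `^ a.
Proof.
move=> a0 + hC.
have pp (i : 'I_m.+1) : is_pmf (P i) by exact: marg_is_pmf.
elim: k => [_|k IH km].
  rewrite big_ord0 /expect /density.
  under eq_bigr do rewrite big_ord0 powR1 mulr1.
  by rewrite (sum_prodm _ pp).
rewrite big_ord_recr/=.
apply: le_trans (ler_wpM2r (powR_ge0 _ _) (IH (ltnW km))).
rewrite -[leLHS](expect_avg (fun i : 'I_m.+1 => P i) (inord k.+1))//.
rewrite /expect mulr_suml; apply: ler_sum => x _.
(* The moment bound is assumed only at states of positive mass. Points of zero product weight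
   contribute nothing, and at all others every marginal factor is positive. *)
have := prodm_ge0 _ x pp; rewrite le_eqVlt => /predU1P[W0|W0].
  by rewrite -[prodlaw P1 K x]/(prodm (fun i : 'I_m.+1 => P i) x) -W0 !mul0r.
rewrite -mulrA ler_wpM2l ?(ltW W0)// /avg inordK ?ltnS//.
have Pk : 0 < P k (x (inord k)).
  rewrite lt_neqAle P_ge0 andbT eq_sym; apply/eqP => Pk.
  move: W0; rewrite /prodm (bigD1 (inord k))//= inordK ?ltnS ?(ltnW km)//.
  by rewrite Pk mul0r ltxx.
apply: le_trans (ler_wpM2l (powR_ge0 _ _) (hC _ _ km Pk)).
rewrite mulr_sumr le_eqVlt; apply/orP; left; apply/eqP/eq_bigr => y _.
by rewrite density_upd// powRM ?density_ge0 ?step_density_ge0// mulrCA.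
Qed.

Lemma joint_deviation_le (f : {ffun 'I_m.+1 -> T} -> R) (a t : R) (C : nat -> R) :
  bounded_diff f -> 1 < a -> 0 < t -> (forall i, 0 <= C i) ->
  (forall i (x : T), (i < m)%N -> 0 < P i x ->
     \sum_y P i.+1 y * step_density i x y `^ a <= C i `^ a) ->
  prob (joint P1 K) (fun x => t <= `|f x - expect (prodlaw P1 K) f|) <=
  (2 * expR (- (2 * m.+1%:R * t ^+ 2))) `^ (a / (a - 1))^-1 *
  \prod_(i < m) C i.
Proof.
move=> bd a1 t0 C0 hC; have a0 : 0 < a by lra.
have pp (i : 'I_m.+1) : is_pmf (P i) by exact: marg_is_pmf.
have W0 x : 0 <= prodlaw P1 K x by exact: (prodm_ge0 _ x pp).
have C_ge0 k : 0 <= \prod_(i < k) C i by exact: prodr_ge0.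
have CE k : \prod_(i < k) C i `^ a = (\prod_(i < k) C i) `^ a.
  elim: k => [|k IH]; first by rewrite !big_ord0 powR1.
  by rewrite !big_ord_recr/= IH powRM ?C_ge0 ?C0.
rewrite /prob; under eq_bigr do rewrite joint_density.
apply: le_trans (sum_hoelder_pred _ _ _ _ _ _ a1 W0 (density_ge0 m)) _.
apply: ler_pM; rewrite ?powR_ge0//.
  have b0 : 0 <= (a / (a - 1))^-1.
    by rewrite invr_ge0 divr_ge0 ?(ltW a0)// subr_ge0 ltW.
  apply: (ge0_ler_powR b0); rewrite ?nnegrE.
  - exact: sumr_ge0.
  - by rewrite mulr_ge0 ?expR_ge0.
  - exact: (mcdiarmid (fun i : 'I_m.+1 => P i)).
rewrite -[leRHS](powRr1 (C_ge0 m)) -[X in _ <= _ `^ X](@mulfV _ a) ?gt_eqF//.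
rewrite powRrM -CE.
apply: ge0_ler_powR; rewrite ?invr_ge0 ?(ltW a0)// ?nnegrE.
- by apply: sumr_ge0 => x _; rewrite mulr_ge0// powR_ge0.
- by apply: prodr_ge0 => i _; exact: powR_ge0.
- exact: density_moment.
Qed.

End fixed_length.
End chain.

(** * Deviation bounds for general and for homogeneous chains *)

Theorem theorem2 (R : realType) (T : finType) (n : nat)
  (P1 : T -> R) (K : nat -> T -> T -> R) (f : {ffun 'I_n -> T} -> R)
  (alpha t : R) :
  (2 <= n)%N ->
  is_pmf P1 -> (forall i, is_stoch (K i)) ->
  bounded_diff f ->
  1 < alpha -> 0 < t ->
  let beta := alpha / (alpha - 1) in
  let P := marg P1 K in
  let Ef := expect (prodlaw P1 K) f in
  let pr := prob (joint P1 K) (fun x => t <= `|f x - Ef|) in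
  let gs := fun i => gamma_star (P i) (K i) alpha in
  (* 1 / (Hoelder conjugate of c) = 1 - 1/c *)
  let ibar := fun c : R => 1 - c^-1 in
  (pr <= 2 `^ beta^-1 *
     expR (- (2 * n%:R * t ^+ 2) / beta +
           \sum_(i < n.-1) (ln (opnorm (bwd (P i) (K i)) (P i) (P i.+1) alpha (gs i))
                            - ibar (gs i) * minlog (P i))))
  /\
  (forall (K0 : T -> T -> R) (normK gK : R),
     (forall i, K i = K0) ->
     (forall i, (i < n.-1)%N ->
        gs i = gK /\ opnorm (bwd (P i) (K i)) (P i) (P i.+1) alpha (gs i) = normK) ->
     let b1 := 2 `^ beta^-1 *
        expR (- (2 * n%:R * t ^+ 2) / beta + (n.-1)%:R * ln normK
              - ibar gK * \sum_(i < n.-1) minlog (P i)) in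
     let b2 := 2 `^ beta^-1 *
        expR (- (2 * n%:R * t ^+ 2) / beta + (n.-1)%:R * ln normK
              - (n.-1)%:R * ibar gK *
                inf [set minlog (P i) | i in [set i : nat | (i < n.-1)%N]]) in
     pr <= b1 /\ b1 <= b2).
Proof.
case: n f => [|m] f // m1 pP1 sK bd a1 t0 beta P Ef pr gs ibar.
have gs_itv i : 1 <= gs i <= alpha.
  by apply: gamma_star_itv => //; exact: marg_is_pmf.
set N := fun i => opnorm (bwd (P i) (K i)) (P i) (P i.+1) alpha (gs i).
have main : pr <= 2 `^ beta^-1 * expR (- (2 * m.+1%:R * t ^+ 2) / beta +
    \sum_(i < m) (ln (N i) - ibar (gs i) * minlog (P i))).
  (* The bound of [density_moment_le] at the exponent [gs i], in exponential form so that the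
     product over i becomes the sum in the exponent. *)
  pose C i := expR (ln (N i) - ibar (gs i) * minlog (P i)).
  apply: le_trans (joint_deviation_le _ _ pP1 sK _ _ _ _ C bd a1 t0 _ _) _.
  - by move=> i; exact: expR_ge0.
  - move=> i x _ Px; apply: density_moment_le => //; first exact: marg_is_pmf.
      by lra.
    by case/andP: (gs_itv i).
  - rewrite powRM ?expR_ge0// -expR_sum expRD mulrA.
    by rewrite [expR _ `^ _]/powR gt_eqF ?expR_gt0// expRK [_^-1 * _]mulrC.
split=> // K0 normK gK _ hK b1 b2; split.
  apply: le_trans main _; rewrite le_eqVlt; apply/orP; left; apply/eqP.
  congr (_ * expR _); rewrite -addrA; congr (_ + _).
  rewrite (eq_bigr (fun i : 'I_m => ln normK - ibar gK * minlog (P i))).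
    by rewrite sumrB -mulr_sumr sumr_const card_ord mulr_natl.
  by move=> i _; have [<- <-] := hK i (ltn_ord i).
rewrite ler_wpM2l ?powR_ge0// ler_expR lerD2l lerN2 [_ * ibar gK]mulrC -mulrA.
(* Since n >= 2 there is at least one transition, and [gK] inherits the bound 1 <= [gs 0]. *)
have ibar0 : 0 <= ibar gK.
  have [<- _] := hK 0%N m1; rewrite subr_ge0; case/andP: (gs_itv 0%N) => g1 _.
  by rewrite invf_le1// (lt_le_trans _ g1).
rewrite ler_wpM2l//= mulr_natl -[X in _ *+ X]card_ord -sumr_const.
apply: ler_sum => i _; apply: ge_inf; last by exists i => //=.
(* The infimum is a lower bound only if the set is bounded below; reindexing by the finite type
   ['I_m] shows that it is. *)
have -> : [set minlog (P i) | i in [set i : nat | (i < m)%N]] =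
    [set minlog (P i) | i in [set: 'I_m]].
  apply/seteqP; split=> [_ [j /= jm <-]|_ [j _ <-]].
    by exists (Ordinal jm).
  by exists j => //=.
exact: has_lbound_fin_image.
Qed.
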